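(* There is an absolute constant $c>0$ such that, for all $n\ge2$, $\rho\in(0,1/2]$, $1\le m\le n-1$ and $s\in(0,1]$, $$\mathcal{E}^{\mathrm{REV}}_{m,s}\le \big(cn^2/(\rho s)\big)^m.$$
   Context: Fix $n\ge 2$ and $\rho\in(0,1/2]$. Let $(G_t)_{t\ge0}$ be undirected graphs on $[n]$, each with a self-loop at every vertex. A reversible averaging system is given by a fixed vector $q\in\mathbb{R}^n$ and, for each $t$, a symmetric nonnegative matrix $M_t$ with the following properties: - $(M_t)_{ij}\neq0$ if and only if $\{i,j\}$ is an edge of $G_t$ (diagonal included); - every nonzero entry of $M_t$ is at least $1$; - $M_t\mathbf{1}=q$ for all $t$; - $q_i\le 1/\rho$ for all $i$. Set $P_t=\mathrm{diag}(q)^{-1}M_t$ and $x(t+1)=P_tx(t)$. Blocks and the $s$-energy are defined as follows. At time $t$, each edge $\{i,j\}$ of $G_t$ with $i\ne j$ is embedded as the closed interval with endpoints $x_i(t)$ and $x_j(t)$. The union of these intervals is a disjoint union of closed intervals (blocks) with lengths $l_1(t),\dots,l_{k_t}(t)$. Then $E_{s,t}=\sum_i l_i(t)^s$ and $E_s=\sum_{t\ge0}E_{s,t}$ for $s\in(0,1]$. $\mathcal{E}^{\mathrm{REV}}_{m,s}$ is the supremum of $E_s$ over all reversible averaging systems (with the given $n,\rho$) in which every $G_t$ has at most $m$ connected components, and over all $x(0)$ with scaled variance $\sum_i q_i(x_i(0)-\mu)^2\le1$, where $\mu=\sum_iq_ix_i(0)/\sum_iq_i$. *)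

(* Defs.v *)
From HB Require Import structures.
From mathcomp Require Import all_boot all_order all_algebra.
From mathcomp Require Import boolp reals exp.

Set Implicit Arguments.
Unset Strict Implicit.
Unset Printing Implicit Defensive.

Import Order.TTheory GRing.Theory Num.Theory.
Local Open Scope ring_scope.

Section ReversibleAveraging.
Variables (R : realType) (n : nat).

Fixpoint traj (q : 'I_n -> R) (M : nat -> 'M[R]_n) (x0 : 'I_n -> R) (t : nat)
  : 'I_n -> R :=
  match t with
  | 0 => x0
  | t'.+1 => fun i => (q i)^-1 * \sum_(j < n) M t' i j * traj q M x0 t' j
  end.

Definition adj (A : 'M[R]_n) : rel 'I_n := fun i j => A i j != 0.

Definition ncomp (A : 'M[R]_n) : nat :=
  #|[set [set j | connect (adj A) i j] | i : 'I_n]|.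

Definition inU (A : 'M[R]_n) (x : 'I_n -> R) (y : R) : Prop :=
  exists i j : 'I_n, i != j /\ A i j != 0 /\
    Num.min (x i) (x j) <= y <= Num.max (x i) (x j).

Definition active (A : 'M[R]_n) (i : 'I_n) : bool :=
  [exists j, (j != i) && (A i j != 0)].

(** x_i and x_j lie in the same block (connected component of U),
    i.e. the closed segment between them lies in U. *)
Definition same_block (A : 'M[R]_n) (x : 'I_n -> R) (i j : 'I_n) : Prop :=
  forall y, Num.min (x i) (x j) <= y <= Num.max (x i) (x j) -> inU A x y.

(** Length of the block containing x_i (for active i): its endpoints are
    vertex positions of active vertices in that block. *)
Definition blen (A : 'M[R]_n) (x : 'I_n -> R) (i : 'I_n) : R :=
  \big[Num.max/x i]_(j | active A j && `[< same_block A x i j >]) x j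
  - \big[Num.min/x i]_(j | active A j && `[< same_block A x i j >]) x j.

(** i is the least-index active vertex of its block (one representative
    per block). *)
Definition block_rep (A : 'M[R]_n) (x : 'I_n -> R) (i : 'I_n) : bool :=
  active A i &&
  `[< forall j, active A j -> same_block A x i j -> (i <= j)%N >].

Definition Est (A : 'M[R]_n) (x : 'I_n -> R) (s : R) : R :=
  \sum_(i | block_rep A x i) powR (blen A x i) s.

Definition rev_system (rho : R) (m : nat) (q : 'I_n -> R)
    (M : nat -> 'M[R]_n) : Prop :=
  (forall t i j, M t i j = M t j i) /\
  (forall t i j, 0 <= M t i j) /\
  (forall t i j, M t i j != 0 -> 1 <= M t i j) /\
  (forall t i, M t i i != 0) /\
  (forall t i, \sum_(j < n) M t i j = q i) /\
  (forall i, q i <= rho^-1) /\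
  (forall t, (ncomp (M t) <= m)%N).

Definition scaled_var (q x : 'I_n -> R) : R :=
  let mu := (\sum_(i < n) q i * x i) / (\sum_(i < n) q i) in
  \sum_(i < n) q i * (x i - mu) ^+ 2.

End ReversibleAveraging.

(* Main.v *)
Require Import Defs.
From HB Require Import structures.
From mathcomp Require Import all_boot all_order all_algebra.
From mathcomp Require Import boolp reals exp.
From mathcomp Require Import ring lra zify.
Import Order.TTheory GRing.Theory Num.Theory.
Local Open Scope ring_scope.

Set Implicit Arguments.
Unset Strict Implicit.
Unset Printing Implicit Defensive.

(** Since [s <= 1], the [s]-th powers of the block lengths sum to at most the
    same sum [E] over the spans of the connected components of the graph; the
    latter is additive over vertex sets that do not interact. Let [V] be the
    scaled variance, and sort the positions at some time [a]. As long as one of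
    the gaps between consecutive positions is not crossed by an edge, the system
    splits into two independent systems with fewer components each, and
    induction on [m] bounds the energy by [2 F(m-1) V^(s/2)]. Once every gap has
    been crossed, each gap [g] has cost [g^2 / 2] in variance, in total at least
    [D^2 / (2n)] where [D] is the diameter at time [a]; as [V <= n D^2 / rho],
    the variance has dropped by the factor [1 - rho / (2 n^2)]. The number of
    components is at most [m] and each span is at most [sqrt (2 V)], so
    [F(m) <= 2 F(m-1) + 2m + (1 - rho s / (8 n^2)) F(m)]. *)

(** * Inequalities for powers with exponent at most 1 *)

Section PowR.
Variable R : realType.
Implicit Types (s x : R).

Lemma ler_powRl s x y : 0 <= s -> 0 <= x -> x <= y -> x `^ s <= y `^ s.
Proof.
by move=> s0 x0 xy; apply: ge0_ler_powR => //; rewrite nnegrE // (le_trans x0).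
Qed.

(** Each share [d i / D] lies in [0, 1], hence is at most its own [s]-th power; the shares sum to 1,
    and multiplying by [D ^ s] gives subadditivity. *)
Lemma powR_sum_le (I : finType) (P : pred I) (d : I -> R) s :
  0 < s -> s <= 1 -> (forall i, P i -> 0 <= d i) ->
  (\sum_(i | P i) d i) `^ s <= \sum_(i | P i) d i `^ s.
Proof.
move=> s0 s1 d0; set D := \sum_(i | P i) d i.
have : 0 <= D by exact: sumr_ge0.
rewrite le_eqVlt => /predU1P[<-|D0].
  by rewrite powR0 ?gt_eqF //; apply: sumr_ge0 => i _; exact: powR_ge0.
have -> : D `^ s = \sum_(i | P i) (d i / D) * D `^ s.
  by rewrite -mulr_suml -mulr_suml divff ?gt_eqF // mul1r.
apply: ler_sum => i Pi; have di := d0 _ Pi.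
have dD : d i <= D by rewrite /D (bigD1 i) //= lerDl sumr_ge0 // => j /andP[/d0].
have [->|dn0] := eqVneq (d i) 0; first by rewrite !mul0r powR_ge0.
have -> : d i `^ s = (d i / D) `^ s * D `^ s.
  by rewrite -powRM ?divr_ge0 // ?ltW // divfK ?gt_eqF.
rewrite ler_wpM2r ?powR_ge0 // ger1_powR // ler_pdivrMr // mul1r dD andbT.
by rewrite divr_gt0 // lt0r dn0.
Qed.

(** With z = a s, the chain is (1 - a)^s <= e^(-z) <= 1/(1 + z) <= 1 - z/2, the last step because z
    <= 1. *)
Lemma powR_1B_le a s : 0 <= a <= 1 -> 0 <= s <= 1 ->
  (1 - a) `^ s <= 1 - a * s / 2.
Proof.
move=> /andP[a0 a1] /andP[s0 s1].
have as0 : 0 <= a * s by rewrite mulr_ge0.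
have as1 : a * s <= 1 by rewrite mulr_ile1.
have e1 : (1 - a) `^ s <= sequences.expR (- a) `^ s.
  by apply: ler_powRl => //; [rewrite subr_ge0 | exact: expR_ge1Dx].
apply: (le_trans e1); rewrite -expRM mulNr expRN.
have e2 := expR_ge1Dx (a * s).
have p0 : 0 < 1 + a * s by rewrite ltr_pwDl.
apply: (@le_trans _ _ (1 + a * s)^-1).
  by rewrite lef_pV2 // posrE // (lt_le_trans p0).
rewrite -[leLHS]mul1r ler_pdivrMr //; nra.
Qed.
End PowR.

(** * Covers of an interval and gaps between sorted reals *)

Section Gaps.
Variable R : realType.

(* The slack [e] lets the interval be consumed from the left, one covering set
   at a time, although the sets may fail to contain their suprema. *)
Lemma cover_le_slack (T : eqType) (l : seq T) (cov : T -> R -> Prop)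
    (d : T -> R) (a b e : R) : 0 < e ->
  (forall C y z, C \in l -> cov C y -> cov C z -> z - y <= d C) ->
  (forall y, a <= y <= b -> exists2 C, C \in l & cov C y) ->
  (forall C, C \in l -> 0 <= d C) ->
  b - a <= \sum_(C <- l) (d C + e).
Proof.
move=> e0; elim: {l}(size l) {-2}l (leqnn (size l)) a => [|k IH] l sl a dc cv d0.
  have /size0nil l0 : size l = 0%N by lia.
  rewrite l0 big_nil subr_le0; have [//|/ltW ab] := leP b a.
  by have [C] := cv a (introT andP (conj (lexx _) ab)); rewrite l0.
have [ba|ab] := ltP b a.
  apply: (@le_trans _ _ 0); first by lra.
  by rewrite big_seq; apply: sumr_ge0 => C /d0; lra.
have [C Cl Ca] := cv a (introT andP (conj (lexx _) ab)).
rewrite (big_rem C) //=.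
(* A point beyond [a + d C + e] cannot lie in the set [C] that covers [a], so the other sets cover
   what remains. *)
suff : b - (a + (d C + e)) <= \sum_(y <- rem C l) (d y + e) by lra.
apply: IH; first by rewrite size_rem //; lia.
- by move=> C' y z /mem_rem; exact: dc.
- move=> y /andP[y1 y2]; have dC := d0 _ Cl.
  have ay : a <= y by lra.
  have [C' C'l C'y] := cv y (introT andP (conj ay y2)).
  exists C' => //; move: C'l; rewrite (perm_mem (perm_to_rem Cl)) inE.
  case/predU1P => [E|//]; rewrite E in C'y.
  by have := dc _ _ _ Cl Ca C'y; lra.
- by move=> C' /mem_rem; exact: d0.
Qed.

Lemma cover_le (T : eqType) (l : seq T) (cov : T -> R -> Prop) (d : T -> R)
    (a b : R) :
  (forall C y z, C \in l -> cov C y -> cov C z -> z - y <= d C) ->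
  (forall y, a <= y <= b -> exists2 C, C \in l & cov C y) ->
  (forall C, C \in l -> 0 <= d C) ->
  b - a <= \sum_(C <- l) d C.
Proof.
move=> dc cv d0; apply/ler_addgt0Pr => e e0.
(* The total slack is at most [e]; the successor keeps the denominator positive for an empty
   cover. *)
pose e' := e / ((size l).+1%:R).
have e'0 : 0 < e' by rewrite divr_gt0.
apply: le_trans (cover_le_slack e'0 dc cv d0) _.
rewrite big_split /= lerD2l big_const_seq count_predT iter_addr addr0.
by rewrite /e' -mulrnAl ler_pdivrMr // -[leLHS]mulr_natr ler_wpM2l ?ltW // ltr_nat.
Qed.

(** The selected gaps are non-overlapping parts of [lo, hi]: their lengths sum to at most [hi - lo],
    and each one is at most [hi - lo]. *)
Lemma sum_gap_sqr_le (p : nat) (y : nat -> R) (P : pred nat) (lo hi : R) :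
  (forall k, (k < p)%N -> y k <= y k.+1) -> lo <= hi ->
  (forall k, (k < p)%N -> P k -> lo <= y k /\ y k.+1 <= hi) ->
  \sum_(0 <= k < p | P k) (y k.+1 - y k) ^+ 2 <= (hi - lo) ^+ 2.
Proof.
(* Clamping to [lo, hi] keeps the selected gaps and makes every other increment nonnegative, so the
   full sum can be telescoped. *)
move=> yS lh Pb; pose cl z := Num.min hi (Num.max lo z).
have cl_homo z z' : z <= z' -> cl z <= cl z'.
  by move=> zz; rewrite /cl !(le_min, ge_min, ge_max, le_max) !lexx zz /= ?orbT.
have sg : \sum_(0 <= k < p | P k) (y k.+1 - y k) <= hi - lo.
  apply: (@le_trans _ _ (\sum_(0 <= k < p) (cl (y k.+1) - cl (y k)))).
    rewrite big_mkcond /=; apply: ler_sum_nat => k /andP[_ kp].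
    case: ifP => Pk; last by rewrite subr_ge0 cl_homo ?yS.
    have [h1 h2] := Pb _ kp Pk; have h3 := yS _ kp.
    by rewrite /cl !max_r ?min_r //; lra.
  rewrite telescope_sumr //; apply: lerB; rewrite /cl ?ge_min ?lexx //.
  by rewrite le_min lh le_max lexx.
apply: (@le_trans _ _ (\sum_(0 <= k < p | P k) (y k.+1 - y k) * (hi - lo))).
  rewrite big_nat_cond [leRHS]big_nat_cond; apply: ler_sum => k /andP[/andP[_ kp] Pk].
  have [h1 h2] := Pb _ kp Pk; have h3 := yS _ kp.
  by rewrite expr2 ler_wpM2l //; lra.
by rewrite -mulr_suml expr2 ler_wpM2r // subr_ge0.
Qed.

(** Cauchy-Schwarz, read off from the nonnegative sum of squared deviations of the gaps from their
    average [c]. *)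
Lemma sqr_sum_gap_le (p : nat) (y : nat -> R) :
  (y p - y 0%N) ^+ 2 <= p%:R * \sum_(0 <= k < p) (y k.+1 - y k) ^+ 2.
Proof.
have [->|p0] := posnP p; first by rewrite subrr expr0n /= mul0r.
pose D := y p - y 0%N; pose c := D / p%:R.
have pR : 0 < p%:R :> R by rewrite ltr0n.
have : 0 <= \sum_(0 <= k < p) (y k.+1 - y k - c) ^+ 2.
  by apply: sumr_ge0 => k _; exact: sqr_ge0.
have -> : \sum_(0 <= k < p) (y k.+1 - y k - c) ^+ 2 =
    \sum_(0 <= k < p) (y k.+1 - y k) ^+ 2 - D ^+ 2 / p%:R.
  transitivity (\sum_(0 <= k < p) ((y k.+1 - y k) ^+ 2
      - 2 * c * (y k.+1 - y k) + c ^+ 2)); first by apply: eq_bigr => k _; ring.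
  rewrite big_split sumrB /= -mulr_sumr telescope_sumr // sumr_const_nat subn0.
  by rewrite -[c ^+ 2 *+ p]mulr_natr /c /D; field; rewrite gt_eqF.
by rewrite subr_ge0 ler_pdivrMr // mulrC.
Qed.

(** [y] is the sorted list of distinct positions. Merging ties makes every gap positive, so that a
    cut at a gap leaves vertices on both sides. *)
Lemma gaps_exist (I : finType) (S : {set I}) (x : I -> R) i0 : i0 \in S ->
  exists (p : nat) (y : nat -> R),
  [/\ (p <= #|S|)%N,
      forall k, (k < p)%N -> y k < y k.+1,
      forall i, i \in S -> y 0%N <= x i <= y p,
      forall k, (k <= p)%N -> exists2 i, i \in S & x i = y k &
      forall k i, (k < p)%N -> i \in S -> x i <= y k \/ y k.+1 <= x i].
Proof.
move=> i0S; pose l := sort <=%R (undup [seq x i | i in S]).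
have l_lt : sorted <%R l by rewrite sort_lt_sorted undup_uniq.
have meml z : z \in l -> exists2 i, i \in S & x i = z.
  by rewrite mem_sort mem_undup => /imageP[i iS ->]; exists i.
have xl i : i \in S -> x i \in l.
  by move=> iS; rewrite mem_sort mem_undup; apply/imageP; exists i.
have sl : (size l <= #|S|)%N.
  by rewrite size_sort (leq_trans (size_undup _)) // size_map -cardE.
clearbody l.
have l0 : (0 < size l)%N by case: l {l_lt meml sl} xl => // /(_ _ i0S).
have mono := lt_sorted_leq_nth 0 l_lt.
have [p szl] : exists p, size l = p.+1 by exists (size l).-1; rewrite prednK.
rewrite szl in mono sl; have monolt := lt_sorted_ltn_nth 0 l_lt.
rewrite szl in monolt.
exists p, (nth 0 l); split.
- exact: ltnW.
- by move=> k kp; rewrite monolt ?inE ?ltnS // ltnW.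
- move=> i /xl il; rewrite -(nth_index 0 il).
  have := index_mem (x i) l; rewrite il szl ltnS => ip.
  by rewrite !mono ?inE ?ltnS.
- by move=> k kp; apply: meml; rewrite mem_nth // szl.
- move=> k i kp /xl il; rewrite -(nth_index 0 il).
  have := index_mem (x i) l; rewrite il szl ltnS => ip.
  have [h|h] := leqP (index (x i) l) k; [left|right];
  by rewrite mono ?inE ?ltnS // ltnW.
Qed.
End Gaps.

(** * Connected components and their spans *)

Section Components.
Variables (R : realType) (n : nat).
Implicit Types (A : 'M[R]_n) (u : 'I_n -> R) (S C : {set 'I_n}) (s : R).

Definition component A i : {set 'I_n} := [set j | connect (adj A) i j].
Definition components A S : {set {set 'I_n}} := [set component A i | i in S].
Definition diam u C : R :=
  \big[Num.max/0]_(p : 'I_n * 'I_n | (p.1 \in C) && (p.2 \in C))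
    `|u p.1 - u p.2|.
(** The index is a set of sets, so a component met by several vertices of [S] counts once. *)
Definition comp_energy A u s S : R := \sum_(C in components A S) diam u C `^ s.

Lemma ncompE A : ncomp A = #|components A setT|.
Proof. by apply: eq_card => C; apply/imsetP/imsetP => -[i _ ->]; exists i. Qed.

Lemma mem_comp A i : i \in component A i.
Proof. by rewrite inE connect0. Qed.

Lemma diam_ge0 u C : 0 <= diam u C.
Proof. exact: bigmax_ge_id. Qed.

Lemma diam_ge u C i j : i \in C -> j \in C -> u i - u j <= diam u C.
Proof.
move=> iC jC; apply: le_trans (ler_norm _) _.
by apply: (@le_bigmax_cond _ _ _ 0 (i, j)); rewrite /= iC.
Qed.

Lemma diam_le u C (d : R) : 0 <= d ->
  (forall i j, i \in C -> j \in C -> u i - u j <= d) -> diam u C <= d.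
Proof.
move=> d0 ud; apply: bigmax_le => // -[i j] /= /andP[iC jC].
by rewrite ler_norml ud // andbT lerNl opprB ud.
Qed.

(** A component meeting [S] meets [L] or [L'], so its nonnegative term occurs at least once on the
    right. *)
Lemma comp_energyU A u s S L L' :
  S \subset L :|: L' ->
  comp_energy A u s S <= comp_energy A u s L + comp_energy A u s L'.
Proof.
move=> SL; rewrite /comp_energy.
rewrite [X in X + _]big_mkcond [X in _ + X]big_mkcond -big_split big_mkcond /=.
apply: ler_sum => C _; have p0 := powR_ge0 (diam u C) s.
case: ifP => [/imsetP[i /(subsetP SL) + ->]|_]; last first.
  by apply: addr_ge0; case: ifP.
rewrite inE => /orP[] /(imset_f (component A)) h.
- by rewrite [_ \in components A L]h lerDl; case: ifP; rewrite ?powR_ge0.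
- by rewrite [_ \in components A L']h lerDr; case: ifP; rewrite ?powR_ge0.
Qed.

Lemma comp_energy0 A u s : comp_energy A u s set0 = 0.
Proof. by rewrite /comp_energy /components imset0 big_set0. Qed.

Section Symmetric.
Variable A : 'M[R]_n.
Hypothesis Asym : forall i j, A i j = A j i.

Lemma adj_connect_sym : connect_sym (adj A).
Proof. by apply: sym_connect_sym => i j; rewrite /adj Asym. Qed.

Lemma comp_eq i j : j \in component A i -> component A j = component A i.
Proof.
rewrite inE => ij; apply/setP => k; rewrite !inE.
by rewrite (same_connect adj_connect_sym ij).
Qed.

Definition closed_in (S : {set 'I_n}) :=
  forall i j, i \in S -> A i j != 0 -> j \in S.

Lemma comp_sub S i : closed_in S -> i \in S -> component A i \subset S.
Proof.
move=> cS iS; apply/subsetP => j; rewrite inE => /connectP[p pp ->].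
by elim: p i iS pp => //= k p IH i iS /andP[ik]; apply: IH; exact: cS ik.
Qed.

(** A closed [L] contains the components of its vertices, so the component of the outside vertex [i]
    is lost. *)
Lemma card_components_lt S L i : closed_in L -> L \subset S -> i \in S :\: L ->
  (#|components A L| < #|components A S|)%N.
Proof.
move=> cL LS; rewrite inE => /andP[iL iS]; apply: proper_card.
apply/properP; split; first exact: imsetS.
exists (component A i); first exact: imset_f.
apply/imsetP => -[j /(comp_sub cL) jL e]; move/subsetP: jL => /(_ i).
by rewrite -e mem_comp (negbTE iL) => /(_ isT).
Qed.

(** * Comparison of blocks with component spans *)

Section Blocks.
Variable u : 'I_n -> R.

Lemma segE y a b :
  (Num.min (u a) (u b) <= y <= Num.max (u a) (u b)) =
  (u a <= y <= u b) || (u b <= y <= u a).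
Proof. by case: (leP (u a) (u b)) => h; apply/idP/idP; lra. Qed.

Lemma same_block_sym i j : same_block A u i j -> same_block A u j i.
Proof. by move=> h y; rewrite minC maxC => /h. Qed.

Lemma same_block_trans i j k :
  same_block A u i j -> same_block A u j k -> same_block A u i k.
Proof.
move=> ij jk y; rewrite segE => h.
have [yij|yij] := boolP (Num.min (u i) (u j) <= y <= Num.max (u i) (u j)).
  exact: ij.
by apply: jk; move: yij; rewrite !segE; lra.
Qed.

Lemma same_block_edge i j : i != j -> A i j != 0 -> same_block A u i j.
Proof. by move=> ij Aij y yij; exists i, j. Qed.

Lemma same_block_refl i : active A i -> same_block A u i i.
Proof.
case/existsP => j /andP[ji Aij] y; rewrite segE => yi.
by exists i, j; rewrite eq_sym ji; do 2!split=> //; rewrite segE; lra.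
Qed.

Lemma same_block_comp i j : active A i -> j \in component A i -> same_block A u i j.
Proof.
move=> ai; rewrite inE => /connectP[p + ->].
suff {p j} H k p : same_block A u i k -> path (adj A) k p ->
  same_block A u i (last k p) by apply: H; exact: same_block_refl.
elim: p k => //= l p IH k ik /andP[kl]; apply: IH.
(* A self-loop on the path embeds no interval, and the vertex does not change. *)
have [<-//|kl'] := eqVneq k l.
exact: same_block_trans ik (same_block_edge kl' kl).
Qed.

Definition block_comps i : {set {set 'I_n}} :=
  [set C in components A setT |
    [exists j in C, active A j && `[< same_block A u i j >]]].

(** Every point between [u k] and [u j] lies on an embedded edge, hence in the hull of a component
    of the block, and intervals are no longer than the total length of a cover. *)
Lemma block_spread_le i j k :
  same_block A u i j -> same_block A u i k ->
  u j - u k <= \sum_(C in block_comps i) diam u C.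
Proof.
move=> ij ik.
rewrite -big_enum /=; apply: (@cover_le _ _ _
  (fun C y => exists a b, [/\ a \in C, b \in C &
     Num.min (u a) (u b) <= y <= Num.max (u a) (u b)])).
- move=> C y z _ [a [b [aC bC]]] + [a' [b' [a'C b'C]]].
  have := diam_ge u aC bC; have := diam_ge u bC aC.
  have := diam_ge u a'C aC; have := diam_ge u a'C bC.
  have := diam_ge u b'C aC; have := diam_ge u b'C bC.
  by rewrite !segE; lra.
- move=> y ykj.
  have H : Num.min (u i) (u j) <= y <= Num.max (u i) (u j) \/
         Num.min (u i) (u k) <= y <= Num.max (u i) (u k).
    by rewrite !segE; lra.
  have [z [iz]] : exists z, same_block A u i z /\
      Num.min (u i) (u z) <= y <= Num.max (u i) (u z).
    by case: H => h; [exists j|exists k].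
  move=> yiz; have [a [b [ab [Aab yab]]]] := iz _ yiz.
  exists (component A a).
    rewrite mem_enum inE imset_f ?inE //=; apply/existsP; exists a.
    rewrite mem_comp /=; apply/andP; split.
      by apply/existsP; exists b; rewrite eq_sym ab.
    (* A point between [u i] and [u a] lies either between [u i] and [u z], inside the block, or
       between [y] and [u a], on the edge from [a] to [b]. *)
    apply/asboolP => w; rewrite segE => wia.
    have [h|h] := boolP (Num.min (u i) (u z) <= w <= Num.max (u i) (u z)).
      exact: iz.
    by exists a, b; do 2!split => //; move: yab yiz h; rewrite !segE; lra.
  exists a, b; rewrite mem_comp yab; split=> //.
  by rewrite inE connect1.
- by move=> C _; exact: diam_ge0.
Qed.

Lemma blen_le i : active A i -> blen A u i <= \sum_(C in block_comps i) diam u C.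
Proof.
move=> ai; have ii := same_block_refl ai; set Z := (X in _ <= X).
have H j k : same_block A u i j -> same_block A u i k -> u j - Z <= u k.
  by move=> ij ik; have := block_spread_le ij ik; rewrite -/Z; lra.
(* The default value [u i] of both extrema is handled as the case of the vertex [i] itself, by
   [ii]. *)
rewrite /blen lerBlDr; apply: bigmax_le => [|j /andP[_ /asboolP ij]];
rewrite -lerBlDl; apply: le_bigmin => [|k /andP[_ /asboolP ik]]; exact: H.
Qed.

Lemma blen_ge0 i : 0 <= blen A u i.
Proof.
by rewrite subr_ge0 (@le_trans _ _ (u i)) ?bigmin_le_id ?bigmax_ge_id.
Qed.

(* A block is covered by the spans of the components meeting it, and no
   component meets two blocks. *)
Lemma Est_le_comp_energy s : 0 < s -> s <= 1 ->
  Est A u s <= comp_energy A u s setT.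
Proof.
move=> s0 s1; apply: (@le_trans _ _
  (\sum_(i | block_rep A u i) \sum_(C in block_comps i) diam u C `^ s)).
  apply: ler_sum => i /andP[ai _].
  apply: (@le_trans _ _ ((\sum_(C in block_comps i) diam u C) `^ s)).
    by apply: ler_powRl; rewrite ?blen_ge0 ?blen_le // ltW.
  by apply: powR_sum_le => // C _; exact: diam_ge0.
rewrite (exchange_big_dep (fun C => C \in components A setT)) /=; last first.
  by move=> i C _; rewrite inE => /andP[].
apply: ler_sum => C CA; rewrite sumr_const.
have p0 := powR_ge0 (diam u C) s.
suff c1 : (#|[pred i | block_rep A u i && (C \in block_comps i)]| <= 1)%N.
  by rewrite -[leRHS]mulr1n ler_wpMn2l.
apply/card_le1P => i /andP[ri Ci] i'.
apply/idP/idP => [/andP[ri' Ci']|]; last by rewrite inE => /eqP ->; apply/andP.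
rewrite inE; apply/eqP.
have wit k : C \in block_comps k -> exists j, [/\ j \in C, active A j & same_block A u k j].
  by rewrite inE => /andP[_ /existsP[j /andP[jC /andP[aj /asboolP kj]]]]; exists j.
have [j [jC aj ij]] := wit _ Ci; have [j' [jC' aj' ij']] := wit _ Ci'.
have jj' : same_block A u j j'.
  apply: same_block_comp => //; case/imsetP: CA => k _ Ck.
  by rewrite (comp_eq (i := k)) -Ck.
have ii' : same_block A u i i'.
  exact: same_block_trans (same_block_trans ij jj') (same_block_sym ij').
case/andP: ri => ai /asboolP ri; case/andP: ri' => ai' /asboolP ri'.
apply/val_inj/eqP; rewrite eqn_leq ri' //= ?ri //; exact: same_block_sym.
Qed.
End Blocks.
End Symmetric.
End Components.

(** * Weighted variance on a set of vertices *)

Section Variance.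
Variables (R : realType) (n : nat) (q : 'I_n -> R).
Hypothesis q_ge1 : forall i, 1 <= q i.
Implicit Types (u : 'I_n -> R) (S : {set 'I_n}).

(** Localized to [S], so that a set without edges to its complement can be treated as a system of
    its own; on [setT] the variance is [scaled_var]. *)
Definition mean S u : R := (\sum_(i in S) q i * u i) / (\sum_(i in S) q i).
Definition moment S c u : R := \sum_(i in S) q i * (u i - c) ^+ 2.
Definition variance S u : R := moment S (mean S u) u.

Let q_gt0 i : 0 < q i. Proof. exact: lt_le_trans (q_ge1 i). Qed.

Lemma moment_ge0 S c u : 0 <= moment S c u.
Proof. by apply: sumr_ge0 => i _; rewrite mulr_ge0 ?sqr_ge0 ?ltW. Qed.

Lemma moment_sub S S' c u : S \subset S' -> moment S c u <= moment S' c u.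
Proof.
move=> /subsetP sS; rewrite /moment big_mkcond [leRHS]big_mkcond /=.
apply: ler_sum => i _; case: ifP => [/sS ->//|_].
by case: ifP => // _; rewrite mulr_ge0 ?sqr_ge0 ?ltW.
Qed.

Lemma sum_q_gt0 S i : i \in S -> 0 < \sum_(i in S) q i.
Proof.
by move=> iS; rewrite (bigD1 i) //= ltr_pwDl // sumr_ge0 // => j _; exact: ltW.
Qed.

(** Steiner's identity: the moment about [c] exceeds the variance by the total weight times the
    squared distance from [c] to the mean. *)
Lemma variance_le_moment S c u : variance S u <= moment S c u.
Proof.
have [->|[i iS]] := set_0Vmem S; first by rewrite /variance /moment !big_set0.
have Q0 := sum_q_gt0 iS; rewrite /variance; set m := mean S u.
have mE : \sum_(i in S) q i * u i = m * \sum_(i in S) q i.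
  by rewrite /m /mean divfK ?gt_eqF.
suff -> : moment S c u = moment S m u + (m - c) ^+ 2 * \sum_(i in S) q i.
  by rewrite lerDl mulr_ge0 ?sqr_ge0 ?ltW.
transitivity (\sum_(i in S) (q i * (u i - m) ^+ 2 + (m - c) ^+ 2 * q i
    + 2 * (m - c) * (q i * u i - m * q i))).
  by apply: eq_bigr => j _; ring.
rewrite 2!big_split /= -!mulr_sumr sumrB -mulr_sumr mE subrr mulr0 addr0 //.
Qed.

Lemma variance_sub S S' u : S \subset S' -> variance S u <= variance S' u.
Proof.
move=> sS; exact: le_trans (variance_le_moment S (mean S' u) u) (moment_sub _ _ sS).
Qed.

(** Weights are at least 1, so the variance dominates a^2 + b^2 for the two deviations a and b, and
    (a - b)^2 <= 2 (a^2 + b^2). *)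
Lemma sqr_dist_le_variance S u i j : i \in S -> j \in S ->
  (u i - u j) ^+ 2 <= 2 * variance S u.
Proof.
move=> iS jS; have [->|ij] := eqVneq i j.
  by rewrite subrr expr0n /= mulr_ge0 // moment_ge0.
rewrite /variance; set m := mean S u; rewrite /moment (bigD1 i) //= (bigD1 j) /=; last first.
  by rewrite jS eq_sym.
set r := \sum_(_ | _) _; have r0 : 0 <= r.
  by apply: sumr_ge0 => k _; rewrite mulr_ge0 ?sqr_ge0 ?ltW.
have a0 : (u i - m) ^+ 2 <= q i * (u i - m) ^+ 2 by rewrite ler_peMl ?sqr_ge0.
have b0 : (u j - m) ^+ 2 <= q j * (u j - m) ^+ 2 by rewrite ler_peMl ?sqr_ge0.
have c0 := sqr_ge0 ((u i - m) + (u j - m)).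
have -> : u i - u j = (u i - m) - (u j - m) by ring.
move: (u i - m) (u j - m) a0 b0 c0 => a b; nra.
Qed.

Lemma mean_bounds S u lo hi i0 : i0 \in S ->
  (forall i, i \in S -> lo <= u i <= hi) -> lo <= mean S u <= hi.
Proof.
move=> i0S b; have Q0 := sum_q_gt0 i0S.
rewrite /mean ler_pdivlMr // ler_pdivrMr // !mulr_sumr.
apply/andP; split; apply: ler_sum => i /b /andP[h1 h2].
- by rewrite [leLHS]mulrC ler_wpM2l // ltW.
- by rewrite [leRHS]mulrC ler_wpM2l // ltW.
Qed.

Lemma variance_le_spread S u lo hi (r : R) i0 : i0 \in S ->
  (forall i, q i <= r) -> (forall i, i \in S -> lo <= u i <= hi) ->
  variance S u <= r * n%:R * (hi - lo) ^+ 2.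
Proof.
move=> i0S qr b; have mb := mean_bounds i0S b.
have D0 := sqr_ge0 (hi - lo); have r0 := le_trans (ltW (q_gt0 i0)) (qr i0).
apply: (@le_trans _ _ (\sum_(i in S) r * (hi - lo) ^+ 2)).
  apply: ler_sum => i /b ib; apply: ler_pM => //; [exact: ltW|exact: sqr_ge0|].
  by rewrite -subr_ge0 subr_sqr mulr_ge0 //; lra.
rewrite sumr_const -[leLHS]mulr_natr [leLHS]mulrAC ler_wpM2r // ler_wpM2l //.
by rewrite ler_nat -[X in (_ <= X)%N]card_ord max_card.
Qed.

(** * Loss of variance in one averaging step *)

Section Step.
Variable A : 'M[R]_n.
Hypothesis A_sym : forall i j, A i j = A j i.
Hypothesis A_ge0 : forall i j, 0 <= A i j.
Hypothesis A_ge1 : forall i j, A i j != 0 -> 1 <= A i j.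
Hypothesis A_diag : forall i, A i i != 0.
Hypothesis A_row : forall i, \sum_j A i j = q i.

Definition step u : 'I_n -> R := fun i => (q i)^-1 * \sum_j A i j * u j.

(** By symmetry the columns also sum to [q], and no nonzero entry joins [S] to its complement. *)
Lemma sum_closed_in S (f : 'I_n -> R) : closed_in A S ->
  \sum_(i in S) \sum_j A i j * f j = \sum_(j in S) q j * f j.
Proof.
move=> cS; rewrite exchange_big /= [RHS]big_mkcond /=; apply: eq_bigr => j _.
rewrite -mulr_suml; case: ifP => jS.
  rewrite -A_row; congr (_ * _); rewrite big_mkcond /=; apply: eq_bigr => i _.
  case: ifP => iS; first exact: A_sym.
  by have [->//|/(cS _ _ jS)] := eqVneq (A j i) 0; rewrite iS.
rewrite big1 ?mul0r // => i iS.
by have [//|/(cS _ _ iS)] := eqVneq (A i j) 0; rewrite jS.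
Qed.

Lemma q_step u i : q i * step u i = \sum_j A i j * u j.
Proof. by rewrite /step mulVKf // gt_eqF. Qed.

Lemma mean_step S u : closed_in A S -> mean S (step u) = mean S u.
Proof.
by move=> cS; rewrite /mean -(sum_closed_in u cS); under eq_bigr do rewrite q_step.
Qed.

(** Steiner's identity for the weights of row [i], whose mean is [step u i]. *)
Lemma moment_split u c i : \sum_j A i j * (u j - c) ^+ 2 =
  q i * (step u i - c) ^+ 2 + \sum_j A i j * (u j - step u i) ^+ 2.
Proof.
set z := step u i; have qz : \sum_j A i j * u j = z * \sum_j A i j.
  by rewrite -q_step A_row mulrC.
transitivity (\sum_j (A i j * (u j - z) ^+ 2 + (z - c) ^+ 2 * A i j
    + 2 * (z - c) * (A i j * u j - z * A i j))).
  by apply: eq_bigr => j _; ring.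
rewrite 2!big_split /= -!mulr_sumr sumrB -mulr_sumr qz subrr mulr0 addr0.
by rewrite A_row addrC mulrC.
Qed.

Lemma variance_step S u : closed_in A S ->
  variance S u =
  variance S (step u) + \sum_(i in S) \sum_j A i j * (u j - step u i) ^+ 2.
Proof.
move=> cS; rewrite /variance mean_step // /moment.
rewrite -(sum_closed_in (fun j => (u j - mean S u) ^+ 2) cS).
by under eq_bigr do rewrite moment_split; rewrite big_split.
Qed.

(** Only the terms of [w] and of the self-loop at [i] are kept; both have weight at least 1. *)
Lemma sqr_edge_le u i w : A i w != 0 ->
  (u w - u i) ^+ 2 <= 2 * \sum_j A i j * (u j - step u i) ^+ 2.
Proof.
move=> iw; set z := step u i.
have t0 j : 0 <= A i j * (u j - z) ^+ 2 by rewrite mulr_ge0 ?sqr_ge0.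
have [->|wi] := eqVneq w i.
  by rewrite subrr expr0n /= mulr_ge0 // sumr_ge0.
rewrite (bigD1 w) //= (bigD1 i) /=; last by rewrite eq_sym.
set r := \sum_(_ | _) _; have r0 : 0 <= r by exact: sumr_ge0.
have a0 : (u w - z) ^+ 2 <= A i w * (u w - z) ^+ 2.
  by rewrite ler_peMl ?sqr_ge0 ?A_ge1.
have b0 : (u i - z) ^+ 2 <= A i i * (u i - z) ^+ 2.
  by rewrite ler_peMl ?sqr_ge0 ?A_ge1.
have c0 := sqr_ge0 ((u w - z) + (u i - z)).
have -> : u w - u i = (u w - z) - (u i - z) by ring.
move: (u w - z) (u i - z) a0 b0 c0 => a b; nra.
Qed.

(* Charging each crossed gap to its left endpoint [v] and comparing with the
   neighbour of [v] farthest to the right loses no factor in the degree. *)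
Lemma sum_crossed_gaps_le S u (p : nat) (y : nat -> R) (K : pred nat) :
  closed_in A S ->
  (forall k, (k < p)%N -> y k <= y k.+1) ->
  (forall k, (k < p)%N -> K k -> exists v w,
     [/\ v \in S, A v w != 0, u v <= y k & y k.+1 <= u w]) ->
  \sum_(0 <= k < p | K k) (y k.+1 - y k) ^+ 2
    <= 2 * (variance S u - variance S (step u)).
Proof.
move=> cS yS cr; rewrite (variance_step u cS) addrAC subrr add0r.
(* The self-loop makes [v] a candidate, so the maximum exists and [u v <= u (W v)]. *)
pose W v := [arg max_(w > v | A v w != 0) u w]%O.
have WA v : A v (W v) != 0 by rewrite /W; case: arg_maxP.
have Wmax v w : A v w != 0 -> u w <= u (W v).
  by move=> vw; rewrite /W; case: arg_maxP => // i _; apply.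
pose Q v k := (u v <= y k) && (y k.+1 <= u (W v)).
apply: (@le_trans _ _ (\sum_(v in S) \sum_(0 <= k < p | Q v k) (y k.+1 - y k) ^+ 2)).
  rewrite (exchange_big_dep xpredT) //= big_mkcond /=; apply: ler_sum_nat => k /andP[_ kp].
  case: ifP => [Kk|_]; last by apply: sumr_ge0 => v _; exact: sqr_ge0.
  have [v [w [vS vw h1 h2]]] := cr _ kp Kk.
  rewrite (bigD1 v) /=; last by rewrite vS /Q h1 (le_trans h2) ?Wmax.
  by rewrite lerDl sumr_ge0 // => ? _; exact: sqr_ge0.
rewrite mulr_sumr; apply: ler_sum => v vS.
(* The gaps charged to [v] all lie within the single edge from [v] to [W v]. *)
apply: le_trans (sqr_edge_le u (WA v)).
apply: sum_gap_sqr_le => // [|k kp /andP[]//]; exact: Wmax.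
Qed.

Lemma variance_step_le S u : closed_in A S ->
  variance S (step u) <= variance S u.
Proof.
move=> cS; rewrite [leRHS](variance_step u cS) lerDl.
by apply: sumr_ge0 => i _; apply: sumr_ge0 => j _; rewrite mulr_ge0 ?sqr_ge0.
Qed.

Lemma step_le S u c : closed_in A S -> (forall i, i \in S -> u i <= c) ->
  forall i, i \in S -> step u i <= c.
Proof.
move=> cS uc i iS; rewrite /step mulrC ler_pdivrMr // -A_row mulr_sumr.
apply: ler_sum => j _; rewrite mulrC; have [->|ij] := eqVneq (A i j) 0.
  by rewrite !mulr0.
by rewrite ler_wpM2r // uc // (cS _ _ iS).
Qed.

Lemma step_ge S u c : closed_in A S -> (forall i, i \in S -> c <= u i) ->
  forall i, i \in S -> c <= step u i.
Proof.
move=> cS uc i iS; rewrite /step mulrC ler_pdivlMr // -A_row mulr_sumr.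
apply: ler_sum => j _; rewrite [leRHS]mulrC; have [->|ij] := eqVneq (A i j) 0.
  by rewrite !mulr0.
by rewrite ler_wpM2r // uc // (cS _ _ iS).
Qed.

End Step.

(** Each squared span is at most twice the variance, and 2^(s/2) <= 2. *)
Lemma comp_energy_le (A : 'M[R]_n) S u (s : R) : closed_in A S ->
  0 < s -> s <= 1 ->
  comp_energy A u s S <= 2 * (#|components A S|)%:R * variance S u `^ (s / 2).
Proof.
move=> cS s0 s1; set V := variance S u.
have V0 : 0 <= V by exact: moment_ge0.
apply: (@le_trans _ _ (\sum_(C in components A S) 2 * V `^ (s / 2))); last first.
  by rewrite sumr_const -[leLHS]mulr_natr mulrAC.
apply: ler_sum => C /imsetP[i iS ->{C}]; have iC := subsetP (comp_sub cS iS).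
have d2 : diam u (component A i) ^+ 2 <= 2 * V.
  rewrite -(sqr_sqrtr (_ : 0 <= 2 * V)) ?mulr_ge0 //.
  rewrite lerXn2r ?nnegrE ?sqrtr_ge0 ?diam_ge0 //.
  apply: diam_le; first exact: sqrtr_ge0.
  move=> j k /iC jS /iC kS; apply: le_trans (ler_norm _) _.
  by rewrite -sqrtr_sqr ler_wsqrtr // sqr_dist_le_variance.
have -> : diam u (component A i) `^ s = (diam u (component A i) ^+ 2) `^ (s / 2).
  rewrite -powR_mulrn ?diam_ge0 // -powRrM; congr (_ `^ _); lra.
have s20 : 0 <= s / 2 by rewrite divr_ge0 // ltW.
apply: le_trans (ler_powRl s20 (sqr_ge0 _) d2) _.
rewrite powRM // ler_wpM2r ?powR_ge0 // ler1_powR //; lra.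
Qed.

End Variance.

(** * Contraction of the variance along a trajectory *)

Section Dynamics.
Variables (R : realType) (n : nat) (q : 'I_n -> R) (rho s : R).
Variables (M : nat -> 'M[R]_n) (x : nat -> 'I_n -> R).
Hypothesis M_sym : forall t i j, M t i j = M t j i.
Hypothesis M_ge0 : forall t i j, 0 <= M t i j.
Hypothesis M_ge1 : forall t i j, M t i j != 0 -> 1 <= M t i j.
Hypothesis M_diag : forall t i, M t i i != 0.
Hypothesis M_row : forall t i, \sum_j M t i j = q i.
Hypothesis q_le : forall i, q i <= rho^-1.
Hypothesis rho0 : 0 < rho.
Hypothesis rho1 : rho <= 2^-1.
Hypothesis s0 : 0 < s.
Hypothesis s1 : s <= 1.
Hypothesis xS : forall t, x t.+1 = step q (M t) (x t).
Implicit Types (S L : {set 'I_n}) (a b t : nat).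

Let q_ge1 i : 1 <= q i.
Proof.
rewrite -(M_row 0%N) (bigD1 i) //= (le_trans (M_ge1 (M_diag 0%N i))) //.
by rewrite lerDl sumr_ge0.
Qed.

Let rho_le1 : rho <= 1.
Proof. by rewrite (le_trans rho1) // invf_le1 ?ler1n. Qed.

Notation V S t := (variance q S (x t)).

(** The interval is half-open: these are the matrices that carry [x a] to [x b]. *)
Definition closed_on S a b := forall t, (a <= t < b)%N -> closed_in (M t) S.

Lemma closed_onW S a b a' b' : (a <= a')%N -> (b' <= b)%N ->
  closed_on S a b -> closed_on S a' b'.
Proof. by move=> aa bb cS t /andP[h1 h2]; apply: cS; lia. Qed.

Lemma variance_anti S a b : (a <= b)%N -> closed_on S a b -> V S b <= V S a.
Proof.
move=> ab; rewrite -(subnKC ab); elim: (b - a)%N => [|d IH] cS.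
  by rewrite addn0.
rewrite addnS in cS *; apply: le_trans (IH (closed_onW (leqnn a) (leqnSn _) cS)).
by rewrite xS; apply: variance_step_le => //; apply: cS; lia.
Qed.

Lemma traj_le S a b c : (a <= b)%N -> closed_on S a b ->
  (forall i, i \in S -> x a i <= c) -> forall i, i \in S -> x b i <= c.
Proof.
move=> ab; rewrite -(subnKC ab); elim: (b - a)%N => [|d IH] cS xc.
  by rewrite addn0.
rewrite addnS in cS *; rewrite xS; apply: step_le => //; first by apply: cS; lia.
exact: IH (closed_onW (leqnn a) (leqnSn _) cS) xc.
Qed.

Lemma traj_ge S a b c : (a <= b)%N -> closed_on S a b ->
  (forall i, i \in S -> c <= x a i) -> forall i, i \in S -> c <= x b i.
Proof.
move=> ab; rewrite -(subnKC ab); elim: (b - a)%N => [|d IH] cS xc.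
  by rewrite addn0.
rewrite addnS in cS *; rewrite xS; apply: step_ge => //; first by apply: cS; lia.
exact: IH (closed_onW (leqnn a) (leqnSn _) cS) xc.
Qed.

Definition crossed S L t :=
  [exists v in L, exists w in S :\: L, M t v w != 0].

Lemma closed_in_uncrossed S L t : L \subset S -> closed_in (M t) S ->
  ~~ crossed S L t -> closed_in (M t) L /\ closed_in (M t) (S :\: L).
Proof.
move=> /subsetP LS cS nc; split=> i j.
  move=> iL ij; have jS := cS _ _ (LS _ iL) ij.
  apply: contraNT nc => jL; apply/existsP; exists i; rewrite iL /=.
  by apply/existsP; exists j; rewrite inE jL jS.
rewrite inE => /andP[iL iS] ij; rewrite inE (cS _ _ iS ij) andbT.
apply: contraNN nc => jL; apply/existsP; exists j; rewrite jL /=.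
by apply/existsP; exists i; rewrite inE iL iS M_sym.
Qed.

Lemma closed_on_uncrossed S L a b : L \subset S -> closed_on S a b ->
  (forall t, (a <= t < b)%N -> ~~ crossed S L t) ->
  closed_on L a b /\ closed_on (S :\: L) a b.
Proof.
by move=> LS cS nc; split=> t tab;
   have [] := closed_in_uncrossed LS (cS t tab) (nc t tab).
Qed.

(** The set is frozen at time [a], so whether a gap has been crossed depends afterwards on the
    graphs alone. *)
Definition lower S a c : {set 'I_n} := [set i in S | x a i <= c].

Lemma lower_sub S a c : lower S a c \subset S.
Proof. by apply/subsetP => i; rewrite inE => /andP[]. Qed.

(* A gap stays free of vertices until it is first crossed, and then the
   crossing edge covers it. *)
Lemma sum_gaps_le_drop S a b (p : nat) (y : nat -> R) :
  (a <= b)%N -> closed_on S a b ->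
  (forall k, (k < p)%N -> y k < y k.+1) ->
  (forall k i, (k < p)%N -> i \in S -> x a i <= y k \/ y k.+1 <= x a i) ->
  (forall k, (k < p)%N ->
     exists2 t, (a <= t < b)%N & crossed S (lower S a (y k)) t) ->
  \sum_(0 <= k < p) (y k.+1 - y k) ^+ 2 <= 2 * (V S a - V S b).
Proof.
move=> ab cS ylt ygap yc.
pose cr k t := crossed S (lower S a (y k)) t.
(* Each gap is paid for only at its first crossing; the variance drops of the steps then
   telescope. *)
pose fc t k := cr k t && all (fun t' => ~~ cr k t') (index_iota a t).
apply: (@le_trans _ _
    (\sum_(a <= t < b) \sum_(0 <= k < p | fc t k) (y k.+1 - y k) ^+ 2)).
  rewrite (exchange_big_dep xpredT) //=; apply: ler_sum_nat => k /andP[_ kp].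
  have ex : exists t, (a <= t < b)%N && cr k t.
    by have [t tab c] := yc _ kp; exists t; rewrite tab.
  case: (ex_minnP ex) => t /andP[tab crt] tmin.
  have fct : fc t k.
    rewrite /fc crt; apply/allP => t'; rewrite mem_index_iota => /andP[h1 h2].
    apply/negP => crt'; have /tmin : (a <= t' < b)%N && cr k t' by rewrite crt'; lia.
    by lia.
  rewrite big_mkcond (bigD1_seq t) ?iota_uniq ?mem_index_iota //= fct lerDl.
  by apply: sumr_ge0 => t' _; case: ifP => // _; exact: sqr_ge0.
have -> : 2 * (V S a - V S b) = \sum_(a <= t < b) 2 * (V S t - V S t.+1).
  rewrite -mulr_sumr (@telescope_sumr_eq _ a b (fun t => - V S t)) //.
    by rewrite opprK addrC.
  by move=> t _; rewrite opprK addrC.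
apply: ler_sum_nat => t /andP[ta tb]; rewrite xS.
apply: sum_crossed_gaps_le => //;
  [exact: M_ge1|by apply: cS; rewrite ta|by move=> k /ylt/ltW|].
move=> k kp /andP[/existsP[v /andP[vL /existsP[w /andP[wL vw]]]] /allP nc].
have cSt : closed_on S a t by apply: closed_onW cS => //; exact: ltnW.
have nct t' : (a <= t' < t)%N -> ~~ crossed S (lower S a (y k)) t'.
  by move=> h; apply: nc; rewrite mem_index_iota.
have [cL cR] := closed_on_uncrossed (lower_sub S a (y k)) cSt nct.
exists v, w; split=> //.
- exact: (subsetP (lower_sub S a (y k))).
- by apply: (traj_le ta cL) vL => i; rewrite inE => /andP[].
- apply: (traj_ge ta cR) wL => i; rewrite !inE => /andP[+ iS].
  by rewrite iS /=; have [->|] := ygap _ _ kp iS.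
Qed.

(** With D the spread at time [a], Cauchy-Schwarz bounds D^2 by 2n times the drop, while rho times
    the variance is at most n D^2. *)
Lemma variance_contract S a b (p : nat) (y : nat -> R) i0 :
  (a <= b)%N -> closed_on S a b -> i0 \in S ->
  (p <= #|S|)%N ->
  (forall k, (k < p)%N -> y k < y k.+1) ->
  (forall i, i \in S -> y 0%N <= x a i <= y p) ->
  (forall k i, (k < p)%N -> i \in S -> x a i <= y k \/ y k.+1 <= x a i) ->
  (forall k, (k < p)%N ->
     exists2 t, (a <= t < b)%N & crossed S (lower S a (y k)) t) ->
  V S b <= (1 - rho / (2 * n%:R ^+ 2)) * V S a.
Proof.
move=> ab cS i0S pS ylt yb ygap yc.
have drop := sum_gaps_le_drop ab cS ylt ygap yc.
have cs := sqr_sum_gap_le p y.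
have sp := variance_le_spread q_ge1 i0S q_le yb.
have pn : (p <= n)%N.
  by apply: leq_trans pS _; rewrite -[X in (_ <= X)%N]card_ord max_card.
have n0 : 0 < n%:R :> R by rewrite ltr0n; case: (n) i0 {i0S} => // -[].
set N : R := n%:R in n0 sp *; set D := y p - y 0%N in cs sp.
have D1 : D ^+ 2 <= N * (2 * (V S a - V S b)).
  apply: le_trans cs _; apply: ler_pM => //; last by rewrite ler_nat.
  by apply: sumr_ge0 => k _; exact: sqr_ge0.
have D2 : rho * V S a <= N * D ^+ 2.
  by rewrite -ler_pdivlMl // mulrA.
have D3 : rho * V S a <= 2 * N ^+ 2 * (V S a - V S b).
  apply: le_trans D2 _; rewrite (_ : 2 * N ^+ 2 * _ = N * (N * (2 * (V S a - V S b)))).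
    by rewrite ler_wpM2l // ltW.
  by ring.
have N2 : 0 < 2 * N ^+ 2 by rewrite mulr_gt0 ?exprn_gt0.
rewrite mulrBl mul1r lerBrDr -lerBrDl mulrAC ler_pdivrMr //.
by rewrite mulrC [leRHS]mulrC mulrC.
Qed.

(** * Recursion for the energy *)

Let B : R := 32 * n%:R ^+ 2 / (rho * s).
Notation W S t := (V S t `^ (s / 2)).
Notation E S t := (comp_energy (M t) (x t) s S).

Lemma variance_ge0 S t : 0 <= V S t.
Proof. exact: moment_ge0. Qed.

Lemma ler_variance_powR S t S' t' : V S t <= V S' t' -> W S t <= W S' t'.
Proof.
move=> h; apply: ler_powRl => //; last exact: variance_ge0.
by rewrite divr_ge0 // ltW.
Qed.

Lemma energy_base_ge0 : 0 <= B.
Proof.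
have rs := mulr_gt0 rho0 s0; apply: divr_ge0; last exact: ltW.
by rewrite mulr_ge0 // sqr_ge0.
Qed.

(** [L] and its complement in [S] evolve independently. Each misses a component of the other, so
    both fall under the bound for [m], and neither has more variance than [S]. *)
Lemma energy_uncrossed_le m S L a b i j :
  (forall S', closed_on S' a b ->
    (forall t, (a <= t < b)%N -> #|components (M t) S'| <= m)%N ->
    \sum_(a <= t < b) E S' t <= B ^+ m * W S' a) ->
  closed_on S a b ->
  (forall t, (a <= t < b)%N -> #|components (M t) S| <= m.+1)%N ->
  L \subset S -> i \in L -> j \in S :\: L ->
  (forall t, (a <= t < b)%N -> ~~ crossed S L t) ->
  \sum_(a <= t < b) E S t <= 2 * B ^+ m * W S a.
Proof.
move=> IH cS mS LS iL jL nc.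
have [cL cR] := closed_on_uncrossed LS cS nc.
have RS : S :\: L \subset S by exact: subsetDl.
have B0 : 0 <= B ^+ m by rewrite exprn_ge0 // energy_base_ge0.
apply: (@le_trans _ _ (\sum_(a <= t < b) (E L t + E (S :\: L) t))).
  apply: ler_sum_nat => t _; apply: comp_energyU.
  by apply/subsetP => k kS; rewrite !inE kS andbT orbN.
rewrite big_split /= (_ : 2 * _ * _ = B ^+ m * W S a + B ^+ m * W S a); last by ring.
apply: lerD.
- apply: le_trans (IH _ cL _) _.
    move=> t tab; rewrite -ltnS; apply: leq_trans (mS _ tab).
    exact: card_components_lt (cL _ tab) LS jL.
  by rewrite ler_wpM2l // ler_variance_powR // variance_sub.
- apply: le_trans (IH _ cR _) _.
    move=> t tab; rewrite -ltnS; apply: leq_trans (mS _ tab).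
    apply: (card_components_lt (i := i) (cR _ tab) RS).
    by rewrite !inE iL (subsetP LS).
  by rewrite ler_wpM2l // ler_variance_powR // variance_sub.
Qed.

Lemma energy_base_ge2 (i : 'I_n) : 2 <= B.
Proof.
have rs := mulr_gt0 rho0 s0; rewrite /B ler_pdivlMr //.
have n1 : 1 <= n%:R :> R by rewrite ler1n; case: (n) i => // -[].
have rs1 : rho * s <= 1 by rewrite mulr_ile1 // ?(ltW rho0) ?(ltW s0) // rho_le1.
nra.
Qed.

(** Lets the number of components at a single time be absorbed into [B ^+ m]. *)
Lemma natr_le_energy_base (m : nat) (i : 'I_n) : m.+1%:R <= B ^+ m.
Proof.
apply: (@le_trans _ _ (2 ^+ m)).
  by rewrite -natrX ler_nat; elim: m => // m IH; rewrite expnS; lia.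
by rewrite lerXn2r ?nnegrE ?energy_base_ge2 ?energy_base_ge0.
Qed.

(** The power s/2 of the contraction factor is at most 1 - rho s / (8 n^2), and the 32 in [B] makes
    [B] times rho s / (8 n^2) equal to 4. *)
Lemma energy_base_contract S a b (i : 'I_n) :
  V S b <= (1 - rho / (2 * n%:R ^+ 2)) * V S a ->
  B * W S b <= (B - 4) * W S a.
Proof.
have n1 : 1 <= n%:R :> R by rewrite ler1n; case: (n) i => // -[].
set N : R := n%:R in n1 *; set al := rho / (2 * N ^+ 2) => h.
have N2 : 0 < 2 * N ^+ 2 by rewrite mulr_gt0 ?exprn_gt0 // (lt_le_trans _ n1).
have al0 : 0 <= al by rewrite divr_ge0 // ltW.
have al1 : al <= 1.
  by rewrite ler_pdivrMr // mul1r (le_trans rho_le1) //; nra.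
have s2 : 0 <= s / 2 by rewrite divr_ge0 // ltW.
have pb : (1 - al) `^ (s / 2) <= 1 - al * (s / 2) / 2.
  apply: powR_1B_le; apply/andP; split=> //.
  by rewrite ler_pdivrMr // mul1r (le_trans s1) // ler1n.
have Wb : W S b <= (1 - al * (s / 2) / 2) * W S a.
  apply: (@le_trans _ _ (((1 - al) * V S a) `^ (s / 2))).
    by apply: ler_powRl => //; exact: variance_ge0.
  by rewrite powRM ?variance_ge0 ?subr_ge0 // ler_wpM2r ?powR_ge0.
apply: le_trans (ler_wpM2l energy_base_ge0 Wb) _.
rewrite [leLHS]mulrA (_ : B * (1 - al * (s / 2) / 2) = B - 4) //.
rewrite /B /al -/N; field.
by rewrite !gt_eqF // (lt_le_trans _ n1).
Qed.

(** Outer induction on [m], inner induction on the length of the time interval. The times before the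
    last first crossing cost [2 * B ^+ m], that time itself another [2 * B ^+ m], and the contracted
    rest [B ^+ m * (B - 4)], each times the initial power of the variance; the sum is exactly
    [B ^+ m.+1]. *)
Lemma energy_le m S a b : (a <= b)%N -> closed_on S a b ->
  (forall t, (a <= t < b)%N -> #|components (M t) S| <= m)%N ->
  \sum_(a <= t < b) E S t <= B ^+ m * W S a.
Proof.
have [d] := ubnP (b - a); elim: m S a b d => [|m IHm] S a b d.
  move=> _ _ _ mS; rewrite big_nat_cond big1.
    by rewrite mulr_ge0 ?powR_ge0 ?exprn_ge0 ?energy_base_ge0.
  move=> t /andP[/mS + _]; rewrite leqn0 cards_eq0 => /eqP h.
  by rewrite /comp_energy h big_set0.
elim: d a b => // d IHd a b dab ab cS mS.
have B0 := energy_base_ge0; have W0 t := powR_ge0 (V S t) (s / 2).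
move: ab; rewrite leq_eqVlt => /predU1P[<-|ab].
  by rewrite big_geq // mulr_ge0 ?exprn_ge0.
have [S0|[i0 i0S]] := set_0Vmem S.
  rewrite S0 big1 ?mulr_ge0 ?powR_ge0 ?exprn_ge0 // => t _.
  exact: comp_energy0.
have [p [y [pS ylt yb yv ygap]]] := gaps_exist (x a) i0S.
pose allcr c := [forall k : 'I_p,
  has (crossed S (lower S a (y k))) (index_iota a c)].
have half c : (a <= c <= b)%N -> ~~ allcr c ->
    \sum_(a <= t < c) E S t <= 2 * B ^+ m * W S a.
  move=> /andP[ac cb] /forallPn[k /hasPn nck].
  have [i iS xi] := yv k (ltnW (ltn_ord k)); have [j jS xj] := yv k.+1 (ltn_ord k).
  apply: (energy_uncrossed_le (L := lower S a (y k)) (i := i) (j := j)) => //.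
  - by move=> S' cS' mS'; exact: (IHm _ _ _ _ (ltnSn _)).
  - exact: closed_onW cS.
  - move=> t /andP[h1 h2]; apply: mS; rewrite h1; exact: leq_trans cb.
  - exact: lower_sub.
  - by rewrite inE iS xi /=.
  - by rewrite !inE jS xj -ltNge ylt.
  - by move=> t tac; apply: nck; rewrite mem_index_iota.
have mB := natr_le_energy_base m i0; have B2 := energy_base_ge2 i0.
have Bm0 : 0 <= B ^+ m by rewrite exprn_ge0.
(* A gap that is never crossed before [b] settles the whole interval, since 2 <= [B]. *)
have [allb|nallb] := boolP (allcr b); last first.
  apply: le_trans (half b _ nallb) _; first by rewrite leqnn ltnW.
  by rewrite ler_wpM2r // exprS ler_wpM2r.
(* The strict bound forces progress: when all positions coincide there is no gap and [allcr a] holds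
   vacuously. *)
have ex : exists c, (a < c <= b)%N && allcr c.
  by exists b; rewrite ab leqnn.
case: (ex_minnP ex) => c /andP[/andP[ac cb] allc] cmin.
case: c ac cb allc cmin => // c ac cb allc cmin; rewrite ltnS in ac.
have contr : V S c.+1 <= (1 - rho / (2 * n%:R ^+ 2)) * V S a.
  apply: (variance_contract (p := p) (y := y) (i0 := i0)) => //.
  - exact: leqW.
  - exact: closed_onW cS.
  - move=> k kp; have /forallP/(_ (Ordinal kp))/hasP[t] := allc.
    by rewrite mem_index_iota => h1 h2; exists t.
have e1 : \sum_(a <= t < c) E S t <= 2 * B ^+ m * W S a.
  (* Either no time precedes [c], or minimality of [c.+1] leaves some gap uncrossed before [c]. *)
  move: (ac); rewrite leq_eqVlt => /predU1P[<-|ac'].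
    by rewrite big_geq // !mulr_ge0.
  apply: half; first by rewrite ac ltnW.
  apply/negP => allc'; have : (a < c <= b)%N && allcr c by rewrite allc' ac' ltnW.
  by move/cmin; rewrite ltnn.
have e2 : E S c <= 2 * B ^+ m * W S a.
  apply: le_trans (comp_energy_le q_ge1 (x c) _ s0 s1) _.
    by apply: cS; rewrite ac.
  apply: ler_pM => //; first by rewrite mulr_ge0.
    rewrite ler_wpM2l // (le_trans _ mB) // ler_nat; apply: mS.
    by rewrite ac.
  apply: ler_variance_powR; apply: variance_anti => //.
  exact: closed_onW (leqnn a) (ltnW cb) cS.
have e3 : \sum_(c.+1 <= t < b) E S t <= B ^+ m.+1 * W S c.+1.
  apply: IHd => //; first by clear -dab ac cb; lia.
    by apply: closed_onW cS => //; exact: leqW.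
  by move=> t /andP[h1 h2]; apply: mS; rewrite h2 andbT (leq_trans ac) // ltnW.
have e4 : B ^+ m.+1 * W S c.+1 <= B ^+ m * ((B - 4) * W S a).
  by rewrite exprSr -mulrA; apply: ler_wpM2l Bm0 _ _ (energy_base_contract i0 contr).
rewrite (big_cat_nat ac (ltnW cb)) /= (big_ltn cb) exprSr.
have e34 := le_trans e3 e4; apply: le_trans (lerD e1 (lerD e2 e34)) _.
by rewrite le_eqVlt; apply/orP; left; apply/eqP; ring.
Qed.

End Dynamics.

(* E^REV_{m,s} <= (c n^2/(rho s))^m, stated as: every partial sum of the
   nonnegative series E_s = sum_t E_{s,t}, for every admissible system and
   initial condition, is bounded by (c n^2/(rho s))^m. *)
Theorem theorem1 (R : realType) :
  exists c : R, 0 < c /\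
  forall (n : nat) (rho : R) (m : nat) (s : R),
    (2 <= n)%N -> 0 < rho -> rho <= 2^-1 ->
    (1 <= m)%N -> (m <= n - 1)%N ->
    0 < s -> s <= 1 ->
    forall (q : 'I_n -> R) (M : nat -> 'M[R]_n) (x0 : 'I_n -> R),
      rev_system rho m q M ->
      scaled_var q x0 <= 1 ->
      forall T : nat,
        \sum_(t < T) Est (M t) (traj q M x0 t) s
          <= (c * (n%:R) ^+ 2 / (rho * s)) ^+ m.
Proof.
exists 32; split=> // n rho m s n2 rho0 rho1 m1 mn s0 s1 q M x0.
move=> [Msym [Mge0 [Mge1 [Mdiag [Mrow [qle Mcomp]]]]]] var1 T.
rewrite -(big_mkord xpredT (fun t => Est (M t) (traj q M x0 t) s)).
apply: (@le_trans _ _ (\sum_(0 <= t < T)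
    comp_energy (M t) (traj q M x0 t) s setT)).
  by apply: ler_sum => t _; exact: Est_le_comp_energy.
have main := @energy_le R n q rho s M (traj q M x0) Msym Mge0 Mge1 Mdiag Mrow
  qle rho0 rho1 s0 s1 (fun=> erefl) m setT 0 T (leq0n T).
apply: le_trans (main _ _) _.
- by move=> t _ i j; rewrite !inE.
- by move=> t _; rewrite -ncompE.
(* The initial variance is at most 1, and hence so is its power s/2. *)
rewrite ler_piMr //.
  apply: exprn_ge0; apply: divr_ge0; first by rewrite mulr_ge0 // sqr_ge0.
  by rewrite ltW // mulr_gt0.
have v0 : 0 <= variance q setT x0.
  apply: moment_ge0 => i; rewrite -(Mrow 0%N) (bigD1 i) //=.
  by rewrite (le_trans (Mge1 _ _ _ (Mdiag 0%N i))) // lerDl sumr_ge0.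
have v1 : variance q setT x0 <= 1.
  have bigT (F : 'I_n -> R) : \sum_(i in setT) F i = \sum_i F i.
    by apply: eq_bigl => i; rewrite inE.
  by rewrite /variance /moment /mean !bigT.
apply: (@le_trans _ _ (1 `^ (s / 2))); last by rewrite powR1.
by apply: ler_powRl => //; rewrite divr_ge0 // ltW.
Qed.
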